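(* Let $k_1,k_2\in\{f,p\}$ and let $C=C^{\pm}_{k_1k_2}$ be a monotone (polarity $+$) or antitone (polarity $-$) context whose holes are of kind $k_2$ and which yields an expression of kind $k_1$. Write $a\sqsubseteq_p b$ for the refinement formula $a\le b$ when $a,b$ are hybrid programs, and $a\sqsubseteq_f b$ for the implication $a\to b$ when $a,b$ are formulas. Then for all expressions $a,b$ of kind $k_2$ the following rules are derivable in dRL: (i) if $C$ is monotone ($+$): from $a\sqsubseteq_{k_2} b$ infer $C(a)\sqsubseteq_{k_1} C(b)$; (ii) if $C$ is antitone ($-$): from $b\sqsubseteq_{k_2} a$ infer $C(a)\sqsubseteq_{k_1} C(b)$. In particular: from $\alpha\le\beta$ infer $C^+_{pp}(\alpha)\le C^+_{pp}(\beta)$; from $\beta\le\alpha$ infer $C^-_{fp}(\alpha)\to C^-_{fp}(\beta)$; from $Q\to P$ infer $C^-_{pf}(P)\le C^-_{pf}(Q)$; and analogously for $C^-_{pp},C^+_{fp},C^+_{pf},C^{\pm}_{ff}$.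
   Context: Differential refinement logic (dRL). Each real-valued variable $x$ has an associated differential variable $x'$; a state assigns a real to every variable and differential variable. Terms: $e::= x\mid n\mid e+e\mid e\cdot e\mid (e)'$ ($n$ an integer, $(e)'$ the differential of $e$). Hybrid programs: $\alpha,\beta::= ?Q\mid x:=e\mid x:=*\mid \{x'=e\,\&\,Q\}\mid \alpha\cup\beta\mid\alpha;\beta\mid\alpha^*$ (test, assignment, nondeterministic assignment, differential equation with evolution domain $Q$, nondeterministic choice, sequential composition, nondeterministic repetition), interpreted as transition relations on states in the standard way. Formulas: $P,Q::= e\le\tilde e\mid\neg P\mid P\land Q\mid\forall x\,P\mid[\alpha]P\mid \alpha\le\beta$, with other connectives derived (e.g. $P\to Q$ abbreviates $\neg(P\land\neg Q)$). $[\alpha]P$ holds in state $\nu$ iff $P$ holds in every state reachable from $\nu$ by $\alpha$; the refinement $\alpha\le\beta$ holds in $\nu$ iff every state reachable from $\nu$ by $\alpha$ is also reachable from $\nu$ by $\beta$; $\alpha\equiv\beta$ abbreviates $\alpha\le\beta\land\beta\le\alpha$. ''Derivable'' means provable in the sound proof calculus of dRL (Loos–Platzer; uniform substitution version by Prebet–Platzer); a rule is derivable if its conclusion is provable from its premises in that calculus. Contexts. $\cdot_p$ is a hole expecting a program, $\cdot_f$ a hole expecting a formula; $C(e)$ denotes the result of substituting $e$ (of the hole's kind) for every occurrence of the hole in $C$. Monotone and antitone contexts $C^{\pm}_{k_1k_2}$ (polarity $\pm$, result kind $k_1\in\{f,p\}$, hole kind $k_2\in\{f,p\}$; $\mp$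 denotes the opposite polarity) are defined simultaneously by the grammar $C^+_{kk}::=\cdot_k$; $C^{\pm}_{pk}::=\alpha\mid ?C^{\pm}_{fk}\mid \{x'=e\,\&\,C^{\pm}_{fk}\}\mid C^{\pm}_{pk};C^{\pm}_{pk}\mid C^{\pm}_{pk}\cup C^{\pm}_{pk}\mid (C^{\pm}_{pk})^*$; $C^{\pm}_{fk}::=P\mid C^{\pm}_{fk}\land C^{\pm}_{fk}\mid\neg C^{\mp}_{fk}\mid\forall x\,C^{\pm}_{fk}\mid [C^{\mp}_{pk}]C^{\pm}_{fk}\mid C^{\mp}_{pk}\le C^{\pm}_{pk}$, where $\alpha$, $P$ are programs/formulas without holes; derived connectives are handled through their definitions (e.g. $C^{\mp}_{fk}\to C^{\pm}_{fk}$ is a $C^{\pm}_{fk}$ context). *)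

(* Defs.v *)
(* Differential refinement logic (dRL).  The calculus follows
   - Loos, Platzer: Differential refinement logic, LICS 2016;
   - Platzer: A complete uniform substitution calculus for differential dynamic
     logic, JAR 2017;
   - Prebet, Platzer: Uniform substitution for differential refinement logic,
     IJCAR 2024.
   Uniform substitution axioms are rendered as the schemata of their instances
   in the symbol-free syntax. *)
From mathcomp Require Import all_boot.
From Stdlib Require Import Reals ZArith Relation_Operators.
From Coquelicot Require Import Coquelicot.

Set Implicit Arguments.
Unset Strict Implicit.
Unset Printing Implicit Defensive.

(* [(n, k)] is the k-th differential variable x^(k) of the n-th base variable,
   so that the variables are closed under x |-> x'. *)
Definition var : Type := (nat * nat)%type.
Definition prime (x : var) : var := (x.1, x.2.+1).

Inductive term : Type :=
| Var (x : var)
| Cst (n : Z)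
| Plus (e g : term)
| Times (e g : term)
| Diff (e : term).

Inductive prog : Type :=
| Test (Q : form)
| Assign (x : var) (e : term)
| AssignAny (x : var)
| ODE (x : var) (e : term) (Q : form)
| Choice (a b : prog)
| Seq (a b : prog)
| Star (a : prog)
with form : Type :=
| Le (e g : term)
| Not (P : form)
| And (P Q : form)
| All (x : var) (P : form)
| Box (a : prog) (P : form)
| Refines (a b : prog).

Definition Imp (P Q : form) : form := Not (And P (Not Q)).
Definition Or (P Q : form) : form := Not (And (Not P) (Not Q)).
Definition Iff (P Q : form) : form := And (Imp P Q) (Imp Q P).
Definition Eq (e g : term) : form := And (Le e g) (Le g e).
Definition Top : form := Le (Cst 0) (Cst 0).
Definition Bot : form := Not Top.
Definition Equiv (a b : prog) : form := And (Refines a b) (Refines b a).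

Declare Scope drl_scope.
Delimit Scope drl_scope with drl.
Bind Scope drl_scope with form.
Bind Scope drl_scope with prog.

Notation "P //\ Q" := (And P Q) (at level 80, right associativity) : drl_scope.
Notation "P --> Q" := (Imp P Q) (at level 90, right associativity) : drl_scope.
Notation "P <--> Q" := (Iff P Q) (at level 95, no associativity) : drl_scope.
(* [a |=> P]: P holds after every run of a. *)
Notation "a |=> P" := (Box a P) (at level 75, right associativity) : drl_scope.
Notation "a <<= b" := (Refines a b) (at level 70, no associativity) : drl_scope.
Notation "a =~= b" := (Equiv a b) (at level 70, no associativity) : drl_scope.
Notation "e =~ g" := (Eq e g) (at level 70, no associativity) : drl_scope.
Notation "a ;; b" := (Seq a b) (at level 60, right associativity) : drl_scope.
Notation "a \++ b" := (Choice a b) (at level 61, right associativity) : drl_scope.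

Definition state : Type := var -> R.
Definition upd (v : state) (x : var) (r : R) : state :=
  fun y => if y == x then r else v y.

Fixpoint vars (e : term) : seq var :=
  match e with
  | Var x => [:: x]
  | Cst _ => [::]
  | Plus e g | Times e g => vars e ++ vars g
  | Diff e => vars e ++ map prime (vars e)
  end.

(* The value of (e)' is the sum over all variables x of
   v(x') * (partial derivative of e by x at v); only the finitely many variables
   of e contribute. *)
Fixpoint eval (e : term) (v : state) : R :=
  match e with
  | Var x => v x
  | Cst n => IZR n
  | Plus e g => (eval e v + eval g v)%R
  | Times e g => (eval e v * eval g v)%R
  | Diff e =>
      \big[Rplus/0%R]_(x <- undup (vars e))
        (v (prime x) * Derive (fun r => eval e (upd v x r)) (v x))%R
  end.

(* [phi] follows x' = e & Q for duration [r] from [v] to [w].  The value of x'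
   in [v] is irrelevant.  [phi] is unconstrained outside [0, r], so asking for a
   two-sided derivative at the end points is no restriction, nor is it any when
   r = 0. *)
Definition ode_flow (x : var) (e : term) (Q : state -> Prop) (v w : state)
    (r : R) (phi : R -> state) : Prop :=
  (0 <= r)%R /\
  (forall y, y <> prime x -> phi 0%R y = v y) /\
  phi r = w /\
  forall t, (0 <= t <= r)%R ->
    (forall y, y <> x -> y <> prime x -> phi t y = v y) /\
    is_derive (fun s => phi s x) t (phi t (prime x)) /\
    phi t (prime x) = eval e (phi t) /\
    Q (phi t).

Fixpoint run (a : prog) (v w : state) {struct a} : Prop :=
  match a with
  | Test Q => w = v /\ sat Q v
  | Assign x e => w = upd v x (eval e v)
  | AssignAny x => exists r, w = upd v x r
  | ODE x e Q => exists r phi, ode_flow x e (sat Q) v w r phi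
  | Choice a b => run a v w \/ run b v w
  | Seq a b => exists u, run a v u /\ run b u w
  | Star a => clos_refl_trans state (run a) v w
  end
with sat (P : form) (v : state) {struct P} : Prop :=
  match P with
  | Le e g => (eval e v <= eval g v)%R
  | Not P => ~ sat P v
  | And P Q => sat P v /\ sat Q v
  | All x P => forall r, sat P (upd v x r)
  | Box a P => forall w, run a v w -> sat P w
  | Refines a b => forall w, run a v w -> run b v w
  end.

Fixpoint BV (a : prog) : seq var :=
  match a with
  | Test _ => [::]
  | Assign x _ | AssignAny x => [:: x]
  | ODE x _ _ => [:: x; prime x]
  | Choice a b | Seq a b => BV a ++ BV b
  | Star a => BV a
  end.

Fixpoint MBV (a : prog) : seq var :=
  match a with
  | Test _ | Star _ => [::]
  | Assign x _ | AssignAny x => [:: x]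
  | ODE x _ _ => [:: x; prime x]
  | Choice a b => [seq x <- MBV a | x \in MBV b]
  | Seq a b => MBV a ++ MBV b
  end.

Definition minus (s t : seq var) : seq var := [seq x <- s | x \notin t].

(* A refinement compares entire final states, hence it also depends on the
   initial value of every variable that may be, but is not certainly,
   overwritten by both sides: [x:=1 <<= ?true] depends on x. *)
Fixpoint FVp (a : prog) : seq var :=
  match a with
  | Test Q => FV Q
  | Assign _ e => vars e
  | AssignAny _ => [::]
  | ODE x e Q => x :: vars e ++ FV Q
  | Choice a b => FVp a ++ FVp b
  | Seq a b => FVp a ++ minus (FVp b) (MBV a)
  | Star a => FVp a
  end
with FV (P : form) : seq var :=
  match P with
  | Le e g => vars e ++ vars g
  | Not P => FV P
  | And P Q => FV P ++ FV Q
  | All x P => minus (FV P) [:: x]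
  | Box a P => FVp a ++ minus (FV P) (MBV a)
  | Refines a b =>
      FVp a ++ FVp b ++
      minus (BV a ++ BV b) [seq x <- MBV a | x \in MBV b]
  end.

Definition disj (s t : seq var) : bool := ~~ has (mem s) t.

(* In a substitution of a term [t] for a variable [z], [z] plays the role of the
   dot in p(.), and P(t) is [subst z t P].  It is admissible ([adm]) when [z] is
   not bound anywhere, no variable of [t] is captured at an occurrence of [z],
   and [z] does not occur under a differential. *)
Fixpoint subst_t (z : var) (t e : term) : term :=
  match e with
  | Var x => if x == z then t else Var x
  | Cst n => Cst n
  | Plus e g => Plus (subst_t z t e) (subst_t z t g)
  | Times e g => Times (subst_t z t e) (subst_t z t g)
  | Diff e => Diff e
  end.

Fixpoint subst_p (z : var) (t : term) (a : prog) : prog :=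
  match a with
  | Test Q => Test (subst z t Q)
  | Assign x e => Assign x (subst_t z t e)
  | AssignAny x => AssignAny x
  | ODE x e Q => ODE x (subst_t z t e) (subst z t Q)
  | Choice a b => Choice (subst_p z t a) (subst_p z t b)
  | Seq a b => Seq (subst_p z t a) (subst_p z t b)
  | Star a => Star (subst_p z t a)
  end
with subst (z : var) (t : term) (P : form) : form :=
  match P with
  | Le e g => Le (subst_t z t e) (subst_t z t g)
  | Not P => Not (subst z t P)
  | And P Q => And (subst z t P) (subst z t Q)
  | All x P => All x (subst z t P)
  | Box a P => Box (subst_p z t a) (subst z t P)
  | Refines a b => Refines (subst_p z t a) (subst_p z t b)
  end.

Fixpoint adm_t (z : var) (e : term) : bool :=
  match e with
  | Var _ | Cst _ => true
  | Plus e g | Times e g => adm_t z e && adm_t z g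
  | Diff e => z \notin vars (Diff e)
  end.

Fixpoint adm_p (z : var) (t : term) (a : prog) : bool :=
  match a with
  | Test Q => adm z t Q
  | Assign x e => (x != z) && adm_t z e
  | AssignAny x => x != z
  | ODE x e Q =>
      [&& x != z, prime x != z, adm_t z e, adm z t Q &
          (z \notin vars e ++ FV Q) || disj [:: x; prime x] (vars t)]
  | Choice a b => adm_p z t a && adm_p z t b
  | Seq a b =>
      [&& adm_p z t a, adm_p z t b &
          (z \notin FVp b) || disj (BV a) (vars t)]
  | Star a => adm_p z t a && ((z \notin FVp a) || disj (BV a) (vars t))
  end
with adm (z : var) (t : term) (P : form) : bool :=
  match P with
  | Le e g => adm_t z e && adm_t z g
  | Not P => adm z t P
  | And P Q => adm z t P && adm z t Q
  | All x P =>
      [&& x != z, adm z t P & (z \notin FV P) || (x \notin vars t)]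
  | Box a P =>
      [&& adm_p z t a, adm z t P & (z \notin FV P) || disj (BV a) (vars t)]
  | Refines a b => adm_p z t a && adm_p z t b
  end.

(* Every formula that is not a negation or a conjunction is an atom. *)
Fixpoint prop_val (V : form -> bool) (P : form) : bool :=
  match P with
  | Not P => ~~ prop_val V P
  | And P Q => prop_val V P && prop_val V Q
  | _ => V P
  end.
Definition tautology (P : form) : Prop := forall V, prop_val V P.

Fixpoint diff_free (e : term) : bool :=
  match e with
  | Var _ | Cst _ => true
  | Plus e g | Times e g => diff_free e && diff_free g
  | Diff _ => false
  end.
Fixpoint fol (P : form) : bool :=
  match P with
  | Le e g => diff_free e && diff_free g
  | Not P => fol P
  | And P Q => fol P && fol Q
  | All _ P => fol P
  | Box _ _ | Refines _ _ => false
  end.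

Local Open Scope drl_scope.

(* [ax_arith] is the usual appeal to real arithmetic; it is the only place where
   the semantics enters the calculus.  Differential ghosts are absent because
   they need systems of differential equations, which the one-variable syntax
   {x' = e & Q} does not have.  In [ax_DI_le] and [ax_DI_lt] the invariant may
   only mention x, since the differential of any other variable y is the value
   of y', which the differential equation does not determine. *)
Inductive axiom : form -> Prop :=
| ax_taut P : tautology P -> axiom P
| ax_arith P : fol P -> (forall v, sat P v) -> axiom P
| ax_all_inst x z e P :
    x \notin FV P -> adm z (Var x) P -> adm z e P ->
    axiom (All x (subst z (Var x) P) --> subst z e P)
| ax_all_dist x P Q : axiom (All x (P --> Q) --> All x P --> All x Q)
| ax_all_vac x P : x \notin FV P -> axiom (P --> All x P)
| ax_eq_subst z e g P :
    adm z e P -> adm z g P ->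
    axiom (e =~ g --> subst z e P --> subst z g P)
| ax_assign x z e P :
    x \notin FV P -> adm z (Var x) P -> adm z e P ->
    axiom (Assign x e |=> subst z (Var x) P <--> subst z e P)
| ax_assign_any x P : axiom (AssignAny x |=> P <--> All x P)
| ax_test Q P : axiom (Test Q |=> P <--> (Q --> P))
| ax_choice a b P : axiom ((a \++ b) |=> P <--> a |=> P //\ b |=> P)
| ax_seq a b P : axiom ((a ;; b) |=> P <--> a |=> b |=> P)
| ax_star a P : axiom (Star a |=> P <--> P //\ a |=> Star a |=> P)
| ax_K a P Q : axiom (a |=> (P --> Q) --> a |=> P --> a |=> Q)
| ax_I a P : axiom (Star a |=> P <--> P //\ Star a |=> (P --> a |=> P))
| ax_V a P : disj (BV a) (FV P) -> axiom (P --> a |=> P)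
| ax_B a x P :
    x \notin FVp a -> x \notin BV a ->
    axiom (All x (a |=> P) --> a |=> (All x P))
| ax_DW x e Q : axiom (ODE x e Q |=> Q)
| ax_DC x e Q S P :
    axiom (ODE x e Q |=> S -->
           (ODE x e Q |=> P <--> ODE x e (Q //\ S) |=> P))
| ax_DE x e Q P :
    axiom (ODE x e Q |=> P <--> ODE x e Q |=> Assign (prime x) e |=> P)
| ax_DI_le x e Q f g :
    prime x \notin FV Q -> {subset vars f ++ vars g <= [:: x]} ->
    axiom ((Q --> Le f g //\ ODE x e Q |=> Le (Diff f) (Diff g)) -->
           ODE x e Q |=> Le f g)
| ax_DI_lt x e Q f g :
    prime x \notin FV Q -> {subset vars f ++ vars g <= [:: x]} ->
    axiom ((Q --> Not (Le g f) //\ ODE x e Q |=> Le (Diff f) (Diff g)) -->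
           ODE x e Q |=> Not (Le g f))
| ax_DS x e Q P t s :
    x \notin vars e -> prime x \notin vars e -> s != t ->
    disj [:: s; t] [:: x, prime x & vars e ++ FV Q ++ FV P] ->
    axiom (ODE x e Q |=> P <-->
           All t (Le (Cst 0) (Var t) -->
                  All s (Le (Cst 0) (Var s) //\ Le (Var s) (Var t) -->
                         Assign x (Plus (Var x) (Times e (Var s))) |=>
                         Assign (prime x) e |=> Q) -->
                  Assign x (Plus (Var x) (Times e (Var t))) |=>
                  Assign (prime x) e |=> P))
| ax_diff_cst n : axiom (Diff (Cst n) =~ Cst 0)
| ax_diff_var x : axiom (Diff (Var x) =~ Var (prime x))
| ax_diff_plus f g : axiom (Diff (Plus f g) =~ Plus (Diff f) (Diff g))
| ax_diff_times f g :
    axiom (Diff (Times f g) =~ Plus (Times (Diff f) g) (Times f (Diff g)))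
| ax_box_ref a b P : axiom (a <<= b --> b |=> P --> a |=> P)
| ax_refl a : axiom (a <<= a)
| ax_trans a b c : axiom (a <<= b //\ b <<= c --> a <<= c)
| ax_ref_test P Q : axiom (Test P <<= Test Q <--> (P --> Q))
| ax_ref_seq a b c d :
    axiom (a <<= c //\ a |=> (b <<= d) --> a ;; b <<= c ;; d)
| ax_ref_choice_l a b c : axiom (a \++ b <<= c <--> a <<= c //\ b <<= c)
| ax_ref_choice_r1 a b c : axiom (a <<= b --> a <<= b \++ c)
| ax_ref_choice_r2 a b c : axiom (a <<= c --> a <<= b \++ c)
| ax_unloop a b : axiom (Star a |=> (a <<= b) --> Star a <<= Star b)
| ax_unfold a : axiom (Star a =~= Test Top \++ (a ;; Star a))
| ax_loop_l a b : axiom (Star a |=> (a ;; b <<= b) --> Star a ;; b <<= b)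
| ax_loop_r a b : axiom (b ;; a <<= b --> b ;; Star a <<= b)
| ax_seq_assoc a b c : axiom (a ;; (b ;; c) =~= (a ;; b) ;; c)
| ax_seq_id_l a : axiom (Test Top ;; a =~= a)
| ax_seq_id_r a : axiom (a ;; Test Top =~= a)
| ax_seq_zero_l a : axiom (Test Bot ;; a =~= Test Bot)
| ax_seq_zero_r a : axiom (a ;; Test Bot =~= Test Bot)
| ax_seq_dist_l a b c : axiom (a ;; (b \++ c) =~= (a ;; b) \++ (a ;; c))
| ax_seq_dist_r a b c : axiom ((a \++ b) ;; c =~= (a ;; c) \++ (b ;; c))
| ax_test_and P Q : axiom (Test P ;; Test Q =~= Test (P //\ Q))
| ax_assign_ref x e :
    x \notin vars e ->
    axiom (Assign x e =~= AssignAny x ;; Test (Var x =~ e))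
| ax_assign_stutter x : axiom (Assign x (Var x) =~= Test Top)
| ax_DR x e Q S :
    axiom (ODE x e Q |=> S --> ODE x e Q <<= ODE x e S)
| ax_ODE_ref x e g Q S :
    axiom (ODE x e Q <<= ODE x g S <-->
           ODE x e Q |=> (Var (prime x) =~ g //\ S))
| ax_DX x e Q :
    prime x \notin vars e ->
    axiom (Assign (prime x) e ;; Test Q <<= ODE x e Q)
| ax_ODE_idem x e Q :
    prime x \notin vars e ->
    axiom (ODE x e Q ;; ODE x e Q =~= ODE x e Q).

Inductive provable (Gamma : form -> Prop) : form -> Prop :=
| pr_prem P : Gamma P -> provable Gamma P
| pr_axiom P : axiom P -> provable Gamma P
| pr_MP P Q : provable Gamma (P --> Q) -> provable Gamma P -> provable Gamma Q
| pr_gen x P : provable Gamma P -> provable Gamma (All x P)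
| pr_G a P : provable Gamma P -> provable Gamma (a |=> P)
| pr_CT_eq f g :
    provable Gamma (f =~ g) -> provable Gamma (Diff f =~ Diff g).

(* The premise of a rule is a global hypothesis: generalization over variables
   and programs ([pr_gen], [pr_G]) applies to it. *)
Definition derivable_rule (prem concl : form) : Prop :=
  provable (fun P => P = prem) concl.

Inductive kind : Type := Fml | Prg.
Inductive polarity : Type := Mono | Anti.

Definition opp (s : polarity) : polarity :=
  match s with Mono => Anti | Anti => Mono end.

Definition expr (k : kind) : Type :=
  match k with Fml => form | Prg => prog end.

(* [ctx k2 k1 s]: contexts with holes of kind [k2], result kind [k1] and
   polarity [s]. *)
Inductive ctx (k2 : kind) : kind -> polarity -> Type :=
| CHole : ctx k2 k2 Mono
| CProg s (a : prog) : ctx k2 Prg s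
| CTest s (C : ctx k2 Fml s) : ctx k2 Prg s
| CODE s (x : var) (e : term) (C : ctx k2 Fml s) : ctx k2 Prg s
| CSeq s (C D : ctx k2 Prg s) : ctx k2 Prg s
| CChoice s (C D : ctx k2 Prg s) : ctx k2 Prg s
| CStar s (C : ctx k2 Prg s) : ctx k2 Prg s
| CForm s (P : form) : ctx k2 Fml s
| CAnd s (C D : ctx k2 Fml s) : ctx k2 Fml s
| CNot s (C : ctx k2 Fml (opp s)) : ctx k2 Fml s
| CAll s (x : var) (C : ctx k2 Fml s) : ctx k2 Fml s
| CBox s (C : ctx k2 Prg (opp s)) (D : ctx k2 Fml s) : ctx k2 Fml s
| CRefines s (C : ctx k2 Prg (opp s)) (D : ctx k2 Prg s) : ctx k2 Fml s.

(* Replacement of all holes; variable capture is intended. *)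
Fixpoint fill (k2 k1 : kind) (s : polarity) (C : ctx k2 k1 s) (a : expr k2)
    : expr k1 :=
  match C in ctx _ k _ return expr k with
  | CHole => a
  | CProg _ b => b
  | CTest _ C => Test (fill C a)
  | CODE _ x e C => ODE x e (fill C a)
  | CSeq _ C D => Seq (fill C a) (fill D a)
  | CChoice _ C D => Choice (fill C a) (fill D a)
  | CStar _ C => Star (fill C a)
  | CForm _ P => P
  | CAnd _ C D => And (fill C a) (fill D a)
  | CNot _ C => Not (fill C a)
  | CAll _ x C => All x (fill C a)
  | CBox _ C D => Box (fill C a) (fill D a)
  | CRefines _ C D => Refines (fill C a) (fill D a)
  end.

Definition below (k : kind) : expr k -> expr k -> form :=
  match k with Fml => Imp | Prg => Refines end.

(* Main.v *)
(* Structural induction on the context, for both polarities at once: an antitone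
   subcontext swaps the two fillings, and with them the premise.  As premises are
   global, the induction hypotheses may be boxed by generalization, which gives
   the local hypotheses of the axioms for sequencing, loops and evolution
   domains. *)
From mathcomp Require Import all_boot.
Require Import Defs.

Set Implicit Arguments.
Unset Strict Implicit.
Unset Printing Implicit Defensive.

Local Open Scope drl_scope.

Section Calculus.

Variable Gamma : form -> Prop.
Local Notation "|- P" := (provable Gamma P) (at level 99).

Lemma provable_imp_refl P : |- P --> P.
Proof. by apply/pr_axiom/ax_taut => V /=; case: (prop_val V P). Qed.

Lemma provable_imp_trans Q P S : |- P --> Q -> |- Q --> S -> |- P --> S.
Proof.
(* Each premise becomes an antecedent of one tautology, which is then checked by truth table. *)
move=> PQ QS; apply: pr_MP QS; apply: pr_MP PQ; apply/pr_axiom/ax_taut => V /=.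
by case: (prop_val V P); case: (prop_val V Q); case: (prop_val V S).
Qed.

Lemma provable_and P Q : |- P -> |- Q -> |- P //\ Q.
Proof.
move=> pP pQ; apply: pr_MP pQ; apply: pr_MP pP; apply/pr_axiom/ax_taut => V /=.
by case: (prop_val V P); case: (prop_val V Q).
Qed.

Lemma provable_iffr P Q : |- P <--> Q -> |- Q -> |- P.
Proof.
move=> PQ pQ; apply: pr_MP pQ; apply: pr_MP PQ; apply/pr_axiom/ax_taut => V /=.
by case: (prop_val V P); case: (prop_val V Q).
Qed.

Lemma provable_curry P Q S : |- P //\ Q --> S -> |- P --> Q --> S.
Proof.
move=> PQS; apply: pr_MP PQS; apply/pr_axiom/ax_taut => V /=.
by case: (prop_val V P); case: (prop_val V Q); case: (prop_val V S).
Qed.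

Lemma provable_swap P Q S : |- P --> Q --> S -> |- Q --> P --> S.
Proof.
move=> PQS; apply: pr_MP PQS; apply/pr_axiom/ax_taut => V /=.
by case: (prop_val V P); case: (prop_val V Q); case: (prop_val V S).
Qed.

Lemma provable_not P Q : |- Q --> P -> |- Not P --> Not Q.
Proof.
apply: pr_MP; apply/pr_axiom/ax_taut => V /=.
by case: (prop_val V P); case: (prop_val V Q).
Qed.

Lemma provable_and_mono P Q P' Q' :
  |- P --> P' -> |- Q --> Q' -> |- P //\ Q --> P' //\ Q'.
Proof.
move=> pP pQ; apply: pr_MP pQ; apply: pr_MP pP; apply/pr_axiom/ax_taut => V /=.
by case: (prop_val V P); case: (prop_val V Q);
   case: (prop_val V P'); case: (prop_val V Q').
Qed.

Lemma provable_all_mono x P Q : |- P --> Q -> |- All x P --> All x Q.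
Proof.
by move=> PQ; apply: pr_MP (pr_axiom _ (ax_all_dist x P Q)) (pr_gen x PQ).
Qed.

Lemma provable_box_post a P Q : |- P --> Q -> |- a |=> P --> a |=> Q.
Proof. by move=> PQ; apply: pr_MP (pr_axiom _ (ax_K a P Q)) (pr_G a PQ). Qed.

(** The implication factors through [b |=> P]: shrink the program first, then weaken the
    postcondition. *)
Lemma provable_box_mono a b P Q :
  |- b <<= a -> |- P --> Q -> |- a |=> P --> b |=> Q.
Proof.
move=> ba PQ; apply: provable_imp_trans (provable_box_post b PQ).
exact: pr_MP (pr_axiom _ (ax_box_ref b a P)) ba.
Qed.

(** Transitivity is used twice, through [b <<= c]. Currying and swapping [ax_trans] lets the
    provable refinement be detached while the other stays an antecedent. *)
Lemma provable_ref_mono a b c d :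
  |- b <<= a -> |- c <<= d -> |- a <<= c --> b <<= d.
Proof.
move=> ba cd; apply: (@provable_imp_trans (b <<= c)).
  exact: pr_MP (provable_curry (pr_axiom _ (ax_trans b a c))) ba.
exact: pr_MP (provable_swap (provable_curry (pr_axiom _ (ax_trans b c d)))) cd.
Qed.

Lemma provable_test_mono P Q : |- P --> Q -> |- Test P <<= Test Q.
Proof. exact: provable_iffr (pr_axiom _ (ax_ref_test P Q)). Qed.

(** By differential weakening [P], hence [Q], holds after every run inside [P]; this is what
    differential refinement [ax_DR] asks for. *)
Lemma provable_ODE_mono x e P Q : |- P --> Q -> |- ODE x e P <<= ODE x e Q.
Proof.
move=> PQ; apply: pr_MP (pr_axiom _ (ax_DR x e P Q)) _.
exact: pr_MP (provable_box_post _ PQ) (pr_axiom _ (ax_DW x e P)).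
Qed.

Lemma provable_seq_mono a b c d :
  |- a <<= c -> |- b <<= d -> |- a ;; b <<= c ;; d.
Proof.
move=> ac bd; apply: pr_MP (pr_axiom _ (ax_ref_seq a b c d)) _.
(* [ax_ref_seq] needs [b <<= d] only after runs of [a]. *)
exact: provable_and ac (pr_G a bd).
Qed.

Lemma provable_choice_mono a b c d :
  |- a <<= c -> |- b <<= d -> |- a \++ b <<= c \++ d.
Proof.
move=> ac bd; apply: provable_iffr (pr_axiom _ (ax_ref_choice_l a b _)) _.
apply: provable_and.
  exact: pr_MP (pr_axiom _ (ax_ref_choice_r1 a c d)) ac.
exact: pr_MP (pr_axiom _ (ax_ref_choice_r2 b c d)) bd.
Qed.

(** [ax_unloop] wants the refinement after any number of iterations of [a]; generalization over
    [Star a] supplies it. *)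
Lemma provable_star_mono a b : |- a <<= b -> |- Star a <<= Star b.
Proof. by move=> ab; apply: pr_MP (pr_axiom _ (ax_unloop a b)) (pr_G _ ab). Qed.

(** Polarity orients only the premise, so that both rules share one conclusion and one induction. *)
Definition below_pol (s : polarity) (k : kind) (a b : expr k) : form :=
  match s with Mono => below a b | Anti => below b a end.

Lemma below_pol_opp s k (a b : expr k) :
  below_pol (opp s) b a = below_pol s a b.
Proof. by case: s. Qed.

Lemma provable_fill k2 k1 s (C : ctx k2 k1 s) (a b : expr k2) :
  |- below_pol s a b -> |- below (fill C a) (fill C b).
Proof.
(* [a] and [b] are generalized because under a negation, and on the left of a box or a refinement,
   the induction hypothesis is used with them exchanged. *)
elim: C a b => {k1 s} /=.
- by [].
- by move=> s c a b _; apply/pr_axiom/ax_refl.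
- by move=> s C IH a b ab; apply/provable_test_mono/IH.
- by move=> s x e C IH a b ab; apply/provable_ODE_mono/IH.
- by move=> s C IHC D IHD a b ab; apply: provable_seq_mono; [apply: IHC|apply: IHD].
- move=> s C IHC D IHD a b ab.
  by apply: provable_choice_mono; [apply: IHC | apply: IHD].
- by move=> s C IH a b ab; apply/provable_star_mono/IH.
- by move=> s P a b _; apply: provable_imp_refl.
- move=> s C IHC D IHD a b ab.
  by apply: provable_and_mono; [apply: IHC | apply: IHD].
- by move=> s C IH a b ab; apply/provable_not/IH; rewrite below_pol_opp.
- by move=> s x C IH a b ab; apply/provable_all_mono/IH.
- move=> s C IHC D IHD a b ab.
  by apply: provable_box_mono; [apply: IHC; rewrite below_pol_opp | apply: IHD].
- move=> s C IHC D IHD a b ab.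
  by apply: provable_ref_mono; [apply: IHC; rewrite below_pol_opp | apply: IHD].
Qed.

End Calculus.

Theorem theorem1 (k1 k2 : kind) :
  (forall (C : ctx k2 k1 Mono) (a b : expr k2),
     derivable_rule (below a b) (below (fill C a) (fill C b))) /\
  (forall (C : ctx k2 k1 Anti) (a b : expr k2),
     derivable_rule (below b a) (below (fill C a) (fill C b))).
Proof. by split=> C a b; apply: provable_fill; apply: pr_prem. Qed.
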